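(* For any two integers $p,q$ with $q\geq 2p-1$, $p\geq 2$ and $q\geq 3$, there exists a graph $G$ such that $\pi_3(G)=p$ and $\pi_3(L(G))=q$, where $L(G)$ denotes the line graph of $G$.
   Context: All graphs are finite, simple and undirected. For a graph $G$ and a set $S\subseteq V(G)$ with $|S|\geq 2$, an $S$-path (path connecting $S$) is a subgraph $P$ of $G$ that is a path with $S\subseteq V(P)$. Two $S$-paths $P,P'$ are internally disjoint if $E(P)\cap E(P')=\varnothing$ and $V(P)\cap V(P')=S$. The local path connectivity $\pi_G(S)$ is the maximum number of pairwise internally disjoint $S$-paths in $G$. For an integer $k$ with $2\leq k\leq |V(G)|$, the path $k$-connectivity is $\pi_k(G)=\min\{\pi_G(S) : S\subseteq V(G),\ |S|=k\}$. *)

(* Defs.v *)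
From mathcomp Require Import all_boot.

Set Implicit Arguments.
Unset Strict Implicit.
Unset Printing Implicit Defensive.

Record sgraph := SGraph {
  vertex :> finType;
  adj : rel vertex;
  adj_sym : symmetric adj;
  adj_irr : irreflexive adj
}.

Definition edges (G : sgraph) : {set {set G}} :=
  [set [set xy.1; xy.2] | xy : G * G & adj xy.1 xy.2].

Section PathConnectivity.
Variable G : sgraph.
Implicit Types (S : {set G}) (P Q : {set G} * {set {set G}}).

(* The subgraph (V(P), E(P)) traced by the walk x :: s; it is a path of G when
   [path adj x s] and [uniq (x :: s)]. *)
Definition trace (x : G) (s : seq G) : {set G} * {set {set G}} :=
  ([set:: x :: s], [set:: pairmap (fun u v => [set u; v]) x s]).

(* P is a subgraph of G, given by its vertex and edge sets, which is a path;
   the two directions of traversal give the same P.  The length bound in the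
   quantifier loses nothing, since vertices are not repeated: see [is_pathP]. *)
Definition is_path P : bool :=
  [exists x : G, exists n : 'I_#|G|, exists s : n.-tuple G,
    [&& path (@adj G) x s, uniq (x :: s) & P == trace x s]].

Lemma is_pathP P :
  reflect (exists x s, [/\ path (@adj G) x s, uniq (x :: s) & P = trace x s])
          (is_path P).
Proof.
apply: (iffP existsP) => [[x /existsP[n /existsP[s /and3P[xs us /eqP ->]]]]|].
  by exists x, s.
move=> [x [s [xs us ->]]]; exists x.
have lt_s : size s < #|G|.
  by rewrite -[_.+1]/(size (x :: s)) -(card_uniqP us) max_card.
apply/existsP; exists (Ordinal lt_s); apply/existsP; exists (in_tuple s).
by rewrite xs us eqxx.
Qed.

Definition Spath S P : bool := is_path P && (S \subset P.1).

Definition internally_disjoint S P Q : bool :=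
  (P.2 :&: Q.2 == set0) && (P.1 :&: Q.1 == S).

(* When #|S| >= 2 an S-path has an edge, so it is not internally disjoint from
   itself, and families of internally disjoint S-paths are sets of S-paths. *)
Definition Spath_packing S (F : {set ({set G} * {set {set G}})}) : bool :=
  [forall P in F, Spath S P] &&
  [forall P in F, forall Q in F, (P != Q) ==> internally_disjoint S P Q].

Definition local_path_connectivity S : nat :=
  \max_(F : {set ({set G} * {set {set G}})} | Spath_packing S F) #|F|.

(* The initial value of the minimum is the maximum of the same family, hence
   does not affect it when 2 <= k <= #|G|: see [path_connectivityP].  For
   k > #|G|, where the minimum is over the empty family, the value is 0. *)
Definition path_connectivity (k : nat) : nat :=
  let m := \max_(S : {set G} | #|S| == k) local_path_connectivity S in
  \big[minn/m]_(S : {set G} | #|S| == k) local_path_connectivity S.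

Lemma path_connectivity_le k S :
  #|S| = k -> path_connectivity k <= local_path_connectivity S.
Proof.
move=> /eqP Sk; rewrite /path_connectivity; move: (\max_(S | _) _) => m /=.
have: S \in index_enum {set G} by rewrite mem_index_enum.
elim: index_enum => //= T r IHr; rewrite inE big_cons => /predU1P[<-|/IHr].
  by rewrite Sk geq_minl.
by case: ifP => // _ le_r; rewrite geq_min le_r orbT.
Qed.

Lemma path_connectivity_small k : #|G| < k -> path_connectivity k = 0.
Proof.
move=> ltGk; have no S : (#|S| == k) = false.
  by apply: contraTF ltGk => /eqP <-; rewrite -leqNgt max_card.
by rewrite /path_connectivity !big_pred0.
Qed.

Lemma path_connectivityP k : k <= #|G| ->
  exists2 S : {set G},
    #|S| = k & path_connectivity k = local_path_connectivity S.
Proof.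
move=> leG.
have [S0 S0k] : exists S : {set G}, #|S| == k.
  have us : uniq (take k (enum G)) by rewrite take_uniq ?enum_uniq.
  exists [set:: take k (enum G)].
  by rewrite cardsE (card_uniqP us) size_takel // -cardE.
have := @arg_minnP _ S0 (fun S => #|S| == k) local_path_connectivity S0k.
case => S /eqP Sk minS.
exists S => //; apply/eqP; rewrite eqn_leq path_connectivity_le //=.
rewrite /path_connectivity; apply: (big_ind (leq _)) => [|m n lem len|T].
- by apply: leq_bigmax_cond; apply/eqP.
- by rewrite leq_min lem len.
- exact: minS.
Qed.

End PathConnectivity.

Section LineGraph.
Variable G : sgraph.

Definition ladj : rel {e : {set G} | e \in edges G} :=
  fun e f => (e != f) && (val e :&: val f != set0).

Fact ladj_sym : symmetric ladj.
Proof. by move=> e f; rewrite /ladj eq_sym setIC. Qed.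

Fact ladj_irr : irreflexive ladj.
Proof. by move=> e; rewrite /ladj eqxx. Qed.

Definition line_graph : sgraph := SGraph ladj_sym ladj_irr.

End LineGraph.

(* Main.v *)
(** Take a large complete graph and two further adjacent vertices u and v, with
u joined to p - 1 and v to q - p + 1 vertices of the complete graph, all
distinct.  Then u has degree p, and the edge uv has degree q in the line graph;
a vertex of S bounds the number of internally disjoint S-paths by its degree,
so both values are upper bounds.  For the lower bounds, any two vertices of the
complete graph, and any two edges other than uv, are joined by a short path
avoiding any prescribed small set, so that paths leaving u, v or uv through
distinct neighbours can be completed greedily.  If S contains both u and v, one
path uses the edge uv and a neighbour of v, and the p - 1 others use up p - 1
further neighbours of v: this needs q - p + 1 >= p. *)

Require Import Defs.
From mathcomp Require Import all_boot zify.

Set Implicit Arguments.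
Unset Strict Implicit.
Unset Printing Implicit Defensive.

(** * Triples and unions of finite sets *)

Lemma card3P (T : finType) (S : {set T}) (a : T) :
  #|S| = 3 -> a \in S ->
  exists b c, [/\ S = a |: [set b; c], a != b, a != c & b != c].
Proof.
move=> cS aS; have : #|S :\ a| == 2 by move: cS; rewrite (cardsD1 a) aS add1n => -[->].
move=> /cards2P[b [c [bc E]]]; exists b, c.
have /setP Eb := E.
have := Eb b; have := Eb c; rewrite !inE !eqxx orbT /=.
by case/andP=> ca _ /andP[ba _]; rewrite -E setD1K // ![a == _]eq_sym.
Qed.

Lemma cardsU_le (T : finType) (A B : {set T}) : #|A :|: B| <= #|A| + #|B|.
Proof. by rewrite leq_card_setU. Qed.

(** * Upper and lower bounds for the number of internally disjoint paths in an arbitrary graph *)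

Section Packing.
Variable H : sgraph.
Implicit Types (S F : {set H}) (x y z : H) (s m : seq H).

Lemma mem_trace2 (r : rel H) x s e : path r x s -> e \in (trace x s).2 ->
  exists y z, [/\ e = [set y; z], r y z, y \in x :: s & z \in x :: s].
Proof.
rewrite inE; elim: s x => //= w s IHs x /andP[rxw ps]; rewrite inE.
case/orP=> [/eqP->|es]; first by exists x, w; rewrite !inE !eqxx !orbT.
have [y [z [-> ryz ys zs]]] := IHs w ps es.
by exists y, z; rewrite ![_ \in _ :: _ :: _]inE ys zs !orbT.
Qed.

Lemma trace_edge x s a : path (@adj H) x s -> 0 < size s -> a \in x :: s ->
  exists2 n, adj a n & [set a; n] \in (trace x s).2.
Proof.
elim: s x => //= w s IHs x /andP[xw ps] _; rewrite inE => /orP[/eqP->|aws].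
  by exists w; rewrite //= !inE eqxx.
have [-> {aws}|a_w] := eqVneq a w.
  by exists x; rewrite 1?adj_sym //= !inE setUC eqxx.
have s0 : 0 < size s by case: s aws {ps IHs} => //=; rewrite inE (negPf a_w).
have [n an es] := IHs w ps s0 aws.
by exists n => //; move: es; rewrite !inE => ->; rewrite orbT.
Qed.

Lemma size_cover S x s : {subset S <= x :: s} -> #|S| <= (size s).+1.
Proof.
move=> Ss; apply: leq_trans (card_size (x :: s)).
by apply: subset_leq_card; apply/subsetP.
Qed.

(** An [S]-path has at least two vertices, hence an edge at [a]. Different paths of a packing use
    different edges there, so choosing the other end of such an edge is injective. *)
Lemma local_path_connectivity_le_degree S a : 1 < #|S| -> a \in S ->
  local_path_connectivity S <= #|[set n | adj a n]|.
Proof.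
move=> S2 aS; apply/bigmax_leqP => F /andP[/forall_inP SF /forall_inP dF].
(* The default [a] never occurs for a path of the packing, as [hP] shows. *)
pose h (P : {set H} * {set {set H}}) :=
  odflt a [pick n | adj a n && ([set a; n] \in P.2)].
have hP P : P \in F -> adj a (h P) && ([set a; h P] \in P.2).
  move=> /SF /andP[/is_pathP[x [s [ps _ ->]]] /subsetP Ss].
  rewrite /h; case: pickP => //= none.
  have Ss' : {subset S <= x :: s} by move=> z /Ss; rewrite inE.
  have [|n an ns] := trace_edge ps _ (Ss' a aS).
    by have := leq_trans S2 (size_cover Ss').
  by have := none n; rewrite an ns.
have hI : {in F &, injective h}.
  move=> P Q PF QF hPQ; apply/eqP/idPn => PQ.
  have /forall_inP/(_ Q QF) := dF P PF; rewrite PQ => /andP[/eqP/setP E _].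
  have /andP[_ e1] := hP P PF; have /andP[_ e2] := hP Q QF.
  by have := E [set a; h P]; rewrite in_set0 in_setI e1 hPQ e2.
rewrite -(card_in_imset hI); apply/subset_leq_card/subsetP => _ /imsetP[P PF ->].
by rewrite inE; have /andP[] := hP P PF.
Qed.

(* S-paths meeting only in S can share an edge only if it lies inside S, so Q
   need only record which of the edges inside S a path may use. *)
Definition sadj S (Q : pred {set H}) : rel H :=
  fun x y => adj x y && ((x \in S) && (y \in S) ==> Q [set x; y]).

Lemma sub_sadj S Q x s : path (sadj S Q) x s -> path (@adj H) x s.
Proof. by apply: sub_path => y z /andP[]. Qed.

(** A common edge of two paths has both ends on both of them, hence in [S]; an edge inside [S] is
    allowed by the [Q i] of at most one path. *)
Lemma packing_of_paths S k (f : 'I_k -> H * seq H) (Q : 'I_k -> pred {set H}) :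
  1 < #|S| ->
  (forall i, path (sadj S (Q i)) (f i).1 (f i).2) ->
  (forall i, uniq ((f i).1 :: (f i).2)) ->
  (forall i, {subset S <= (f i).1 :: (f i).2}) ->
  (forall i j y, i != j -> y \in (f i).1 :: (f i).2 ->
     y \in (f j).1 :: (f j).2 -> y \in S) ->
  (forall i j e, i != j -> Q i e -> ~~ Q j e) ->
  k <= local_path_connectivity S.
Proof.
move=> S2 pf uf Sf If Qd; pose t i := trace (f i).1 (f i).2.
have dE i j : i != j -> (t i).2 :&: (t j).2 = set0.
  move=> ij; apply/setP => e; rewrite in_setI in_set0; apply/negP => /andP[].
  move=> /(mem_trace2 (pf i))[y [z [-> /andP[_ Qi] yi zi]]] ej.
  have [y' [z' [E /andP[_ Qj] yj zj]]] := mem_trace2 (pf j) ej.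
  have inj w : w \in [set y; z] -> w \in (f j).1 :: (f j).2.
    by rewrite E !inE => /orP[] /eqP ->; [have:=yj|have:=zj]; rewrite inE.
  have ini w : w \in [set y'; z'] -> w \in (f i).1 :: (f i).2.
    by rewrite -E !inE => /orP[] /eqP ->; [have:=yi|have:=zi]; rewrite inE.
  have yS : y \in S by apply: If ij yi (inj y _); rewrite !inE eqxx.
  have zS : z \in S by apply: If ij zi (inj z _); rewrite !inE eqxx orbT.
  have yS' : y' \in S by apply: If ij (ini y' _) yj; rewrite !inE eqxx.
  have zS' : z' \in S by apply: If ij (ini z' _) zj; rewrite !inE eqxx orbT.
  move: Qi Qj; rewrite yS zS yS' zS' /= -E => Qi.
  by rewrite (negPf (Qd _ _ _ ij Qi)).
(* A packing is a set, so its size is [k] only if the traces are distinct. Equal traces would share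
   an edge, since an [S]-path has one. *)
have tI : injective t.
  move=> i j tij; apply/eqP/idPn => ij; have /setP := dE i j ij.
  have [a aS] : exists a, a \in S by apply/card_gt0P; apply: ltnW.
  have [|n _ ns] := trace_edge (sub_sadj (pf i)) _ (Sf i a aS).
    by have := leq_trans S2 (size_cover (@Sf i)).
  by move/(_ [set a; n]); rewrite -tij in_setI in_set0 ns.
have := @leq_bigmax_cond _ (Spath_packing S) (fun A => #|A|) (t @: setT).
rewrite card_imset // cardsT card_ord; apply.
apply/andP; split.
  apply/forall_inP => _ /imsetP[i _ ->]; apply/andP; split.
    by apply/is_pathP; exists (f i).1, (f i).2; split=> //; apply: sub_sadj (pf i).
  by apply/subsetP => z /(Sf i); rewrite [in X in _ -> X]inE.
apply/forall_inP => _ /imsetP[i _ ->]; apply/forall_inP => _ /imsetP[j _ ->].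
apply/implyP => tij; have ij : i != j by apply: contraNneq tij => ->.
rewrite /internally_disjoint dE // eqxx /=; apply/eqP/setP => z.
rewrite in_setI 2!in_set; apply/andP/idP => [[zi zj]|zS]; first exact: If ij zi zj.
by split; apply: Sf.
Qed.

(* T i consists of vertices reserved for the i-th path. *)
Lemma greedy_packing S k M c (D : {set H}) (T : 'I_k -> {set H})
    (Q : 'I_k -> pred {set H}) :
  1 < #|S| -> (forall i, T i \subset D) -> #|D| + k * c <= M ->
  (forall i j y, i != j -> y \in T i -> y \notin T j) ->
  (forall i j e, i != j -> Q i e -> ~~ Q j e) ->
  (forall i F, #|F| <= M -> exists x s,
     [/\ path (sadj S (Q i)) x s, uniq (x :: s), {subset S <= x :: s},
         size s < c &
         {in x :: s, forall y, [|| y \in S, y \in T i | y \notin F]}]) ->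
  k <= local_path_connectivity S.
Proof.
move=> S2 TD DM Td Qd ex.
case: (posnP k) => [->//|k0].
have [x0 _] : exists x, x \in S by apply/card_gt0P; apply: ltnW.
(* Invariant: [F] contains [D] and, up to [S], the vertices of the first [n] paths, at most [c] for
   each. The next path then avoids [F] outside [S] and its own reserved set. *)
have {ex} step n : n <= k -> exists (f : 'I_k -> H * seq H) F,
  [/\ #|F| <= #|D| + n * c, D \subset F,
  forall i : 'I_k, i < n -> {subset (f i).1 :: (f i).2 <= F :|: S} &
  (forall i : 'I_k, i < n -> [/\ path (sadj S (Q i)) (f i).1 (f i).2,
    uniq ((f i).1 :: (f i).2), {subset S <= (f i).1 :: (f i).2} &
    {in (f i).1 :: (f i).2, forall y, [|| y \in S, y \in T i | y \notin D]}]) /\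
  (forall (i j : 'I_k) y, i < j -> j < n -> y \in (f i).1 :: (f i).2 ->
     y \in (f j).1 :: (f j).2 -> y \in S)].
  elim: n => [|n IHn] nk.
    by exists (fun=> (x0, [::])), D; split; rewrite ?leq_addr.
  have [f [F [cF DF fF [fok If]]]] := IHn (ltnW nk).
  have lM : #|F| <= M by nia.
  have [x [s [ps us Ss sc xF]]] := ex (Ordinal nk) F lM.
  exists (fun i : 'I_k => if i == n :> nat then (x, s) else f i), (F :|: [set:: x :: s]).
  split.
  - apply: (leq_trans (cardsU_le _ _)).
    rewrite mulSn [c + _]addnC addnA leq_add // cardsE.
    exact: leq_trans (card_size (x :: s)) sc.
  - by apply: subset_trans DF _; apply: subsetUl.
  - move=> i; rewrite ltnS leq_eqVlt; case: eqP => /= [_ _|_ /fF iF] y ys.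
      by rewrite 2!in_setU [in X in _ || X || _]in_set ys orbT.
    by have := iF y ys; rewrite 3!in_setU => /orP[] ->; rewrite ?orbT.
  split.
    move=> i; rewrite ltnS leq_eqVlt; case: eqP => /= [ni _|_ /fok //].
    have <- : Ordinal nk = i by apply/val_inj.
    split=> // y /xF; case: (y \in S) (y \in T _) => [|] [|] //=.
    by apply: contra; apply: (subsetP DF).
  move=> i j y ij; rewrite ltnS leq_eqVlt => /orP[/eqP jn|jn].
    (* A vertex outside [S] common to an earlier path and the new one lies in [F], so it must be
       reserved for the new path. It is then in [D], so it is also reserved for the earlier path,
       against the disjointness of the reserved sets. *)
    rewrite jn eqxx ltn_eqF -?jn //= => yi /xF /or3P[//|yT|yF].
      have [_ _ _ /(_ y yi)] := fok i (leq_trans ij (eq_leq jn)).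
      case/or3P=> // [yT'|]; last by rewrite (subsetP (TD _) _ yT).
      have in' : i != Ordinal nk by rewrite -val_eqE /= -jn ltn_eqF.
      by have := Td _ _ _ in' yT'; rewrite yT.
    have := fF i (leq_trans ij (eq_leq jn)) y yi.
    by rewrite in_setU (negPf yF).
  rewrite !ltn_eqF //; last exact: ltn_trans jn.
  exact: If.
have [f [F [_ _ _ [fok If]]]] := step k (leqnn k).
apply: (@packing_of_paths S k f Q) => //; try by move=> i; have [] := fok i (ltn_ord i).
move=> i j y; rewrite neq_ltn => /orP[] ij yi yj.
  exact: If ij (ltn_ord j) yi yj.
exact: If ij (ltn_ord i) yj yi.
Qed.

(** * Completing paths through links of bounded length *)

(** Since [m] is non-empty, a link does not use the edge from [x] to [y] itself. The ends may lie in
    [F], and putting them there keeps [m] away from them. *)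
Definition linked (R : {set H}) M := forall x y F,
  x \in R -> y \in R -> #|F| <= M -> exists m,
  [/\ path (@adj H) x (rcons m y), uniq m, 0 < size m <= 3 &
      {in m, forall z, z \notin F}].

(** The link is chosen to avoid [F], the path so far and [y]. Its interior misses [S], so every new
    edge has an end outside [S] and is not restricted by [Q]. It adds at most three interior
    vertices and [y]. *)
Lemma link_extend S Q R M x s y F :
  linked R M -> S \subset F -> #|F| + size s + 2 <= M ->
  path (sadj S Q) x s -> uniq (x :: s) -> last x s \in R -> y \in R ->
  y \notin x :: s ->
  exists2 s', [/\ path (sadj S Q) x s', uniq (x :: s'),
    size s' <= size s + 4 & last x s' = y] &
    {subset x :: s <= x :: s'} /\
    {in x :: s', forall z, [|| z \in x :: s, z == y | z \notin F]}.
Proof.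
move=> lR SF cF ps us lx yR yxs.
have cF' : #|F :|: [set:: y :: x :: s]| <= M.
  apply: (leq_trans (cardsU_le _ _)).
  have : #|[set:: y :: x :: s]| <= size (y :: x :: s) by rewrite cardsE card_size.
  move=> /=; lia.
have [m [pm um /andP[m0 m3] mF]] := lR _ _ _ lx yR cF'.
have mF1 : {in m, forall z, z \notin F}.
  by move=> z /mF; apply: contra => zF; rewrite in_setU zF.
have mF2 : {in m, forall z, z \notin y :: x :: s}.
  by move=> z /mF; apply: contra => zF; rewrite in_setU in_set zF orbT.
exists (s ++ rcons m y); split.
- rewrite cat_path ps /=; case: m pm um m0 mF1 {m3 mF mF2} => //= z m.
  move=> /andP[lz pm] _ _ mF.
  have nS w : w \in z :: m -> w \in S = false.
    by move=> /mF; apply: contraNF; apply: (subsetP SF).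
  rewrite {1}/sadj lz (nS z) ?mem_head // andbF /= {mF lz}.
  elim: m z pm nS => /= [|w m IHm] z; rewrite /sadj => /andP[-> pm] nS.
    by rewrite nS ?mem_head.
  rewrite [z \in S]nS ?mem_head //=; apply: IHm => // t tm.
  by apply: nS; rewrite inE tm orbT.
- rewrite -cat_cons cat_uniq us rcons_uniq um andbT /=; apply/andP; split.
    apply/hasPn => z; rewrite mem_rcons in_cons => /predU1P[->//|/mF2].
    by rewrite inE negb_or => /andP[].
  by apply/negP => /mF2; rewrite mem_head.
- by rewrite size_cat size_rcons addnS -addnS leq_add2l.
- by rewrite last_cat last_rcons.
- by move=> z; rewrite -cat_cons mem_cat => ->.
move=> z; rewrite -cat_cons mem_cat mem_rcons in_cons.
by case/or3P=> [->|->|/mF1 ->]; rewrite ?orbT.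
Qed.

(* The i-th path leaves a through r i and then d i, which may be b or c. *)
Lemma packing_from_prefixes R M k a b c (r : 'I_k -> seq H) (d : 'I_k -> H) :
  linked R M -> 15 * k + 30 <= M ->
  a != b -> a != c -> b != c -> b \in R -> c \in R ->
  (forall i, d i \in R) -> injective d ->
  (forall i, size (r i) <= 1) ->
  (forall i, path (@adj H) a (rcons (r i) (d i))) ->
  (forall i, uniq (a :: rcons (r i) (d i))) ->
  (forall i x, x \in r i -> x \notin a |: [set b; c]) ->
  (forall i j x, i != j -> x \in r i -> x \notin rcons (r j) (d j)) ->
  k <= local_path_connectivity (a |: [set b; c]).
Proof.
move=> lR kM ab ac bc bR cR dR dI r1 pr ur rS rd.
set S := a |: [set b; c].
have cS : #|S| = 3 by rewrite /S cardsU1 cards2 !inE negb_or ab ac bc.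
pose T i := [set:: rcons (r i) (d i)].
pose D := \bigcup_i T i.
have cD : #|D| <= k * 2.
  have -> : k * 2 = \sum_(i < k) 2 by rewrite sum_nat_const card_ord.
  rewrite /D; elim/big_ind2: _ => [|A m B n hA hB|i _]; first by rewrite cards0.
    by apply: (leq_trans (cardsU_le _ _)); apply: leq_add.
  rewrite cardsE; apply: leq_trans (card_size _) _; rewrite size_rcons ltnS; exact: r1.
(* At most [2k] vertices are reserved. A prefix has at most two edges and each of the two links adds
   at most four, so a path has at most 11 vertices, and [2k + 12k] is at most [15k + 3]. Adding [S]
   and a partial path stays within [15k + 30]. The one edge inside [S] granted to the [i]-th path is
   that from [a] to [d i]. *)
apply: (@greedy_packing S k (15 * k + 3) 12 D T (fun i e => e == [set a; d i])).
- by rewrite cS.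
- by move=> i; apply: bigcup_sup.
- lia.
- move=> i j y ij; rewrite !inE mem_rcons in_cons => /predU1P[->|yi]; last exact: rd yi.
  rewrite mem_rcons in_cons (inj_eq dI) negb_or ij /=.
  apply/negP => dj; have := rd j i _ _ dj; rewrite eq_sym ij mem_rcons mem_head.
  by move/(_ isT).
- move=> i j _ ij /eqP->; apply/eqP => /setP /(_ (d i)); rewrite !inE eqxx orbT.
  rewrite (inj_eq dI) (negPf ij) orbF => /esym/eqP da.
  by have := ur i; rewrite /= da mem_rcons mem_head.
move=> i F cF; set Q := (Q in sadj S Q).
have cSF : #|F :|: S| <= 15 * k + 6.
  by apply: (leq_trans (cardsU_le _ _)); rewrite cS; lia.
set s0 := rcons (r i) (d i).
(* If [r i] is empty, the only edge is the one granted by [Q]; otherwise the intermediate vertex is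
   outside [S], which frees both edges. *)
have p0 : path (sadj S Q) a s0.
  have := pr i; have := rS i; have := r1 i; rewrite /s0.
  case: (r i) => [|x [|//]] /= _ rS'; rewrite /sadj ?andbT.
    by move=> ->; rewrite /= /Q eqxx implybT.
  by move=> /andP[-> ->]; rewrite (negPf (rS' x _)) ?mem_head ?andbF.
have z0 : size s0 <= 2 by rewrite size_rcons ltnS r1.
have in0 z : z \in a :: s0 -> (z \in S) || (z \in T i).
  rewrite inE => /predU1P[->|zs]; first by rewrite !inE eqxx.
  by rewrite [z \in T i]inE zs orbT.
have n0 z : z \in S -> z != a -> z != d i -> z \notin a :: s0.
  move=> zS za zd; rewrite in_cons (negPf za) mem_rcons in_cons (negPf zd) /=.
  by apply/negP => /rS; rewrite zS.
(* When [d i] is already one of [b], [c], a single link to the other one suffices. *)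
have aux b' c' : S = a |: [set b'; c'] -> b' != c' -> a != c' -> c' \in R ->
    d i = b' -> exists x s,
     [/\ path (sadj S Q) x s, uniq (x :: s), {subset S <= x :: s},
         size s < 12 &
         {in x :: s, forall y, [|| y \in S, y \in T i | y \notin F]}].
  move=> ES bc' ac' cR' db.
  have [|||s [ps us zs ls] [ss js]] :=
    @link_extend S Q R M a s0 c' (F :|: S) lR (subsetUr _ _) _ p0 (ur i) _ cR'.
  - by clear -kM cSF z0; lia.
  - by rewrite last_rcons.
  - by apply: n0; rewrite ?ES ?inE ?eqxx ?orbT // eq_sym ?db.
  exists a, s; split=> //; last 2 first.
  - by clear -zs z0; lia.
  - move=> z /js /or3P[/in0/orP[]->|/eqP->|]; rewrite ?orbT //.
      by rewrite ES !inE eqxx !orbT.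
    by rewrite in_setU negb_or => /andP[->]; rewrite !orbT.
  rewrite ES => z; rewrite !inE => /or3P[] /eqP ->; rewrite ?eqxx //.
    by rewrite -in_cons; apply: ss; rewrite in_cons -db mem_rcons mem_head orbT.
  by rewrite -in_cons -ls mem_last.
have [db|db] := eqVneq (d i) b; first exact: (aux b c).
have [dc|dc] := eqVneq (d i) c.
  by apply: (aux c b) => //; [rewrite /S [[set c; b]]setUC | rewrite eq_sym].
(* Otherwise one link leads from [d i] to [b] and a second one from [b] to [c]. *)
have [|||s [ps us zs ls] [ss js]] :=
    @link_extend S Q R M a s0 b (F :|: S) lR (subsetUr _ _) _ p0 (ur i) _ bR.
- by clear -kM cSF z0; lia.
- by rewrite last_rcons.
- by apply: n0; rewrite ?inE ?eqxx ?orbT // eq_sym.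
have [|||t [pt ut zt lt] [st it]] :=
    @link_extend S Q R M a s c (F :|: S) lR (subsetUr _ _) _ ps us _ cR.
- by clear -kM cSF z0 zs; lia.
- by rewrite ls.
- apply/negP => /js /or3P[|/eqP cb|].
  + apply/negP; apply: n0; rewrite ?inE ?eqxx ?orbT // eq_sym //.
  + by rewrite cb eqxx in bc.
  + by rewrite !inE eqxx !orbT.
exists a, t; split=> //.
- move=> z; rewrite in_setU1 in_set2 => /or3P[] /eqP ->.
  + exact: mem_head.
  + by apply: st; rewrite -ls mem_last.
  + by rewrite -lt mem_last.
- by clear -z0 zs zt; lia.
have inF z : z \notin F :|: S -> [|| z \in S, z \in T i | z \notin F].
  by rewrite in_setU negb_or => /andP[->]; rewrite !orbT.
move=> z /it /or3P[/js/or3P[/in0/orP[]->|/eqP->|/inF//]|/eqP->|/inF//];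
  by rewrite ?orbT // !inE eqxx ?orbT.
Qed.

(** Each path goes from [a] to [b] to [c] by two links. Nothing is reserved and no edge inside [S]
    is used, hence [set0] and [pred0]. *)
Lemma packing_linked R M k a b c :
  linked R M -> 15 * k + 30 <= M ->
  a != b -> a != c -> b != c -> a \in R -> b \in R -> c \in R ->
  k <= local_path_connectivity (a |: [set b; c]).
Proof.
move=> lR kM ab ac bc aR bR cR; set S := a |: [set b; c].
have cS : #|S| = 3 by rewrite /S cardsU1 cards2 !inE negb_or ab ac bc.
apply: (@greedy_packing S k (15 * k + 3) 12 set0 (fun=> set0) (fun _ => pred0)).
- by rewrite cS.
- by [].
- rewrite cards0; lia.
- by move=> *; rewrite in_set0.
- by [].
move=> i F cF.
have cSF : #|F :|: S| <= 15 * k + 6.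
  by apply: (leq_trans (cardsU_le _ _)); rewrite cS; lia.
have [||s [ps us zs ls] [ss js]] :=
    @link_extend S pred0 R M a [::] b (F :|: S) lR (subsetUr _ _) _ isT isT aR bR.
- by clear -kM cSF => /=; lia.
- by rewrite inE eq_sym.
have [|||t [pt ut zt lt] [st it]] :=
    @link_extend S pred0 R M a s c (F :|: S) lR (subsetUr _ _) _ ps us _ cR.
- by clear -kM cSF zs; move: zs => /=; lia.
- by rewrite ls.
- apply/negP => /js /or3P[|/eqP cb|].
  + by rewrite inE eq_sym (negPf ac).
  + by rewrite cb eqxx in bc.
  + by rewrite !inE eqxx !orbT.
exists a, t; split=> //.
- move=> z; rewrite in_setU1 in_set2 => /or3P[] /eqP ->.
  + exact: mem_head.
  + by apply: st; rewrite -ls mem_last.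
  + by rewrite -lt mem_last.
- by clear -zs zt; move: zs zt => /=; lia.
have inF z : z \notin F :|: S -> [|| z \in S, z \in set0 | z \notin F].
  by rewrite in_setU negb_or => /andP[->]; rewrite !orbT.
move=> z /it /or3P[/js/or3P[|/eqP->|/inF//]|/eqP->|/inF//];
  rewrite ?inE ?eqxx ?orbT //.
by move=> /eqP->; rewrite eqxx.
Qed.

End Packing.

(** * The graph and its path 3-connectivity *)

Section Construction.
Variables p q n : nat.

(* inl true is u, inl false is v. *)
Definition attached_adj : rel (bool + 'I_n.+1) := fun x y =>
  match x, y with
  | inl b, inl b' => b != b'
  | inl b, inr i | inr i, inl b => (i < q) && (b == (i < p.-1))
  | inr i, inr j => i != j
  end.

Lemma attached_adj_sym : symmetric attached_adj.
Proof. by move=> [b|i] [b'|j] //=; rewrite eq_sym. Qed.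

Lemma attached_adj_irr : irreflexive attached_adj.
Proof. by move=> [b|i] /=; rewrite eqxx. Qed.

Definition attached_graph : sgraph := SGraph attached_adj_sym attached_adj_irr.

Local Notation G := attached_graph.
Local Notation L := (line_graph attached_graph).
(** The bound [15 * k + 30] of the packing lemmas at [k = q], the largest number of paths
    required. *)
Local Notation M := (15 * q + 30).

Hypotheses (hp : 1 < p) (hq : 2 * p - 1 <= q) (hn : 2 * M + 6 <= n).

(* K i is a junk value for i > n. *)
Definition K (i : nat) : G := inr (inord i).

Lemma K_inj i j : i < q -> j < q -> (K i == K j) = (i == j).
Proof.
move=> iq jq; rewrite -[LHS]/(inord i == inord j) -val_eqE /= !inordK //; lia.
Qed.

Lemma adj_K b i : i < q -> @adj G (inl b) (K i) = (b == (i < p.-1)).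
Proof. by move=> iq; rewrite /= inordK ?iq //; lia. Qed.

Lemma fresh_ord (A : {set 'I_n.+1}) : #|A| <= n -> exists i, i \notin A.
Proof.
move=> cA; have : 0 < #|~: A| by have := cardsC A; rewrite card_ord; lia.
by case/card_gt0P=> i; rewrite inE; exists i.
Qed.

Definition clique : {set G} := [set x | if x is inr _ then true else false].

(** A single clique vertex [z] is the whole link: it has to avoid [F] and the two ends, at most
    [M + 2] of the [n + 1] clique vertices. *)
Lemma linked_clique : linked clique M.
Proof.
move=> [//|i] [//|j] F; rewrite ?inE // => _ _ cF.
have [|z] := @fresh_ord ([set z | inr z \in F] :|: [set i; j]).
  apply: (leq_trans (cardsU_le _ _)).
  have c2 : #|[set i; j]| <= 2 by rewrite cards2; case: (i != j).
  apply: leq_trans (leq_add (leq_trans _ cF) c2) _; last by lia.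
  rewrite -(@card_imset _ _ (inr : _ -> G)); last by move=> ? ? [].
  by apply/subset_leq_card/subsetP => _ /imsetP[z + ->]; rewrite inE.
rewrite !inE !negb_or => /and3P[zF zi zj].
exists [:: (inr z : G)]; split=> //=; first by rewrite eq_sym zi zj.
by move=> t; rewrite mem_seq1 => /eqP->.
Qed.

Lemma cliqueP (x : G) : x != inl true -> x != inl false -> x \in clique.
Proof. by case: x => [[]|i] // _ _; rewrite in_set. Qed.

Lemma degree_true : #|[set x : G | @adj G (inl true) x]| <= p.
Proof.
(* The last index [p - 1] stands for the neighbour v of u. *)
pose f (i : 'I_p) : G := if i < p.-1 then K i else inl false.
apply: (@leq_trans #|f @: setT|); last first.
  by apply: leq_trans (leq_imset_card _ _) _; rewrite cardsT card_ord.
apply/subset_leq_card/subsetP => -[[]|i]; rewrite inE //= => h; apply/imsetP.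
  have lp : p.-1 < p by lia.
  by exists (Ordinal lp); rewrite // /f /= ltnn.
have /andP[_ /eqP/esym ip] := h.
have lp : i < p by lia.
by exists (Ordinal lp); rewrite // /f /= ip /K inord_val.
Qed.

(** For [i < p - 1] the path is u, [K i], [c], [y i], v; the last one is u, v, [y i], [c].
    Coinciding vertices are merged when [c] is [K i] or [y i]. The [p] neighbours [y i] of v have
    indices up to [2p - 2], which is below [q] by [hq]. *)
Lemma packing_two_special (c : 'I_n.+1) :
  p <= local_path_connectivity (inl true |: [set inl false; inr c] : {set G}).
Proof.
set S : {set G} := (S in local_path_connectivity S).
pose y i := K (p.-1 + i).
pose s (i : 'I_p) : seq G :=
  if i < p.-1 then
    if K i == inr c then [:: inr c; y i; inl false] else
    if y i == inr c then [:: K i; inr c; inl false] else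
    [:: K i; inr c; y i; inl false]
  else if y i == inr c then [:: inl false; inr c] else [:: inl false; y i; inr c].
pose T (i : 'I_p) : {set G} := [set z | (z == y i) || (i < p.-1) && (z == K i)].
(* Merging vertices puts an edge from u or v to [c] on the path; at most one index [i] has [K i] or
   [y i] equal to [c]. The edge uv belongs to the last path. *)
pose Q (i : 'I_p) (e : {set G}) :=
  [|| [&& e == [set inl true; inr c], K i == inr c & i < p.-1],
      (e == [set inl false; inr c]) && (y i == inr c) |
      (e == [set inl true; inl false]) && (i == p.-1 :> nat)].
have yI (i j : 'I_p) : (y i == y j) = (i == j).
  have ik := ltn_ord i; have jk := ltn_ord j.
  by rewrite K_inj ?eqn_add2l //; lia.
have yK (i j : 'I_p) : j < p.-1 -> (y i == K j) = false.
  by move=> jp; have ik := ltn_ord i; rewrite K_inj; lia.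
have KI (i j : 'I_p) : (K i == K j) = (i == j).
  by have ik := ltn_ord i; have jk := ltn_ord j; rewrite K_inj //; lia.
have e1 : [set inl true; inr c] == [set inl false; inr c] :> {set G} = false.
  by apply/eqP => /setP /(_ (inl true)); rewrite !inE.
have e2 : [set inl true; inr c] == [set inl true; inl false] :> {set G} = false.
  by apply/eqP => /setP /(_ (inr c)); rewrite !inE eqxx orbT.
have e3 : [set inl false; inr c] == [set inl true; inl false] :> {set G} = false.
  by apply/eqP => /setP /(_ (inr c)); rewrite !inE eqxx orbT.
(* All vertices of these explicit paths are in [S] or reserved, so [D] may be the whole vertex set;
   5 bounds the number of vertices of a path. *)
apply: (@greedy_packing G S p (#|G| + p * 5) 5 setT T Q).
- by rewrite /S cardsU1 cards2 !inE.
- by move=> i; apply: subsetT.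
- by rewrite cardsT.
- move=> i j z ij; rewrite !inE => /orP[/eqP->|/andP[ip /eqP->]]; rewrite negb_or.
    by rewrite yI (negPf ij) /= negb_and; case: ltnP => //= jp; rewrite yK.
  by rewrite eq_sym yK //= KI (negPf ij) andbF.
- move=> i j e ij; rewrite /Q => /or3P[].
  + case/and3P=> /eqP-> /eqP cE _.
    by rewrite e1 e2 -cE KI [j == i]eq_sym (negPf ij) eqxx andbF.
  + case/andP=> /eqP-> /eqP cE; rewrite [_ == [set inl true; inr c]]eq_sym.
    by rewrite e1 e3 -cE yI [j == i]eq_sym (negPf ij) eqxx.
  + case/andP=> /eqP-> /eqP ip.
    rewrite ![[set inl true; inl false] == _]eq_sym e2 e3 eqxx /=.
    by rewrite -ip; apply: contra ij => /eqP/val_inj->.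
move=> i F _; exists (inl true), (s i).
have ik := ltn_ord i.
have pi : (i < p.-1) || (i == p.-1 :> nat) by clear -ik; lia.
have au : i < p.-1 -> @adj G (inl true) (K i) by move=> ip; rewrite adj_K ?ip //; lia.
have av : @adj G (inl false) (y i) by rewrite adj_K; lia.
have av' : @adj G (y i) (inl false) by rewrite adj_sym.
have aK (x z : G) : x \in clique -> z \in clique -> x != z -> @adj G x z.
  by case: x => [?|?]; case: z => [?|?]; rewrite !inE.
have subS (l : seq G) : inl true \in l -> inl false \in l -> inr c \in l ->
    {subset S <= l}.
  by move=> ? ? ? z; rewrite !inE => /or3P[] /eqP->.
have inT (l : seq G) :
    all (fun z => [|| z \in S, z == y i | (i < p.-1) && (z == K i)]) l ->
    {in l, forall z, [|| z \in S, z \in T i | z \notin F]}.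
  by move=> /allP lT z /lT /or3P[->|zy|zK]; rewrite // [z \in T i]in_set ?zy ?zK ?orbT.
have stl x z : adj x z -> x \notin S -> sadj S (Q i) x z.
  by move=> xz xS; rewrite /sadj xz (negPf xS).
have str x z : adj x z -> z \notin S -> sadj S (Q i) x z.
  by move=> xz xS; rewrite /sadj xz (negPf xS) andbF.
have stq x z : adj x z -> Q i [set x; z] -> sadj S (Q i) x z.
  by move=> xz qi; rewrite /sadj xz qi implybT.
have KS : (K i == inr c) = false -> K i \notin S by rewrite !inE /= => ->.
have yS : (y i == inr c) = false -> y i \notin S by rewrite !inE /= => ->.
have uS : inl true \in S by rewrite !inE.
have vS : inl false \in S by rewrite !inE.
have cS : inr c \in S by rewrite !inE eqxx !orbT.
rewrite /s; case: ifP => ip; first case: ifP => [/eqP Kc|Kc];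
  last case: ifP => [/eqP yc|yc].
- have yc : (y i == inr c) = false by rewrite -Kc yK.
  split=> //.
  + apply/and4P; split=> //.
    * by apply: stq; [rewrite -Kc au | rewrite /Q Kc ip !eqxx].
    * by apply: str; [apply: aK; rewrite ?inE // eq_sym yc | apply: yS].
    * by apply: stl; [| apply: yS].
  + by rewrite /= !inE /= eq_sym yc.
  + by apply: subS; rewrite !inE ?eqxx ?orbT.
  + by apply: inT; rewrite /= uS cS vS eqxx !orbT.
- case: ifP => [/eqP yc|yc]; split=> //.
  + apply/and4P; split=> //.
    * by apply: str; [exact: au | exact: KS].
    * by apply: stl; [apply: aK; rewrite ?inE // Kc | exact: KS].
    * by apply: stq; [rewrite -yc | rewrite /Q setUC yc !eqxx orbT].
  + by rewrite /= !inE /= Kc.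
  + by apply: subS; rewrite !inE ?eqxx ?orbT.
  + by apply: inT; rewrite /= uS cS vS ip eqxx !orbT.
  + apply/and5P; split=> //.
    * by apply: str; [exact: au | exact: KS].
    * by apply: stl; [apply: aK; rewrite ?inE // Kc | exact: KS].
    * by apply: str; [apply: aK; rewrite ?inE // eq_sym yc | exact: yS].
    * by apply: stl; [| exact: yS].
  + by rewrite /= !inE /= Kc orbF eq_sym yK // eq_sym yc.
  + by apply: subS; rewrite !inE ?eqxx ?orbT.
  + by apply: inT; rewrite /= uS cS vS ip !eqxx !orbT.
- have ip' : i == p.-1 :> nat by move: pi; rewrite ip.
  split=> //.
  + apply/and3P; split=> //.
    * by apply: stq; rewrite // /Q ip' eqxx !orbT.
    * by apply: stq; [rewrite -yc | rewrite /Q yc !eqxx orbT].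
  + by apply: subS; rewrite !inE ?eqxx ?orbT.
  + by apply: inT; rewrite /= uS cS vS.
- have ip' : i == p.-1 :> nat by move: pi; rewrite ip.
  split=> //.
  + apply/and4P; split=> //.
    * by apply: stq; rewrite // /Q ip' eqxx !orbT.
    * by apply: str; [| exact: yS].
    * by apply: stl; [apply: aK; rewrite ?inE // yc | exact: yS].
  + by rewrite /= !inE /= yc.
  + by apply: subS; rewrite !inE ?eqxx ?orbT.
  + by apply: inT; rewrite /= uS cS vS eqxx !orbT.
Qed.

Lemma packing_attached (S : {set G}) :
  #|S| = 3 -> p <= local_path_connectivity S.
Proof.
move=> cS; have pM : 15 * p + 30 <= M by lia.
have one b : inl b \in S -> inl (~~ b) \notin S -> p <= local_path_connectivity S.
  move=> bS nbS; have [x [y [ES bx by_ xy]]] := card3P cS bS.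
  have xyR z : z \in S -> inl b != z -> z \in clique.
    move=> zS bz; case: z zS bz => [b'|i]; rewrite !inE //.
    by case: b b' nbS {bS ES bx by_} => [] [] //= /negPf->.
  have xR : x \in clique by apply: xyR; rewrite // ES !inE eqxx orbT.
  have yR : y \in clique by apply: xyR; rewrite // ES !inE eqxx !orbT.
  rewrite ES; case: b bS nbS {xyR} ES bx by_ => /= bS nbS ES bx by_.
    (* From u, the first [p - 1] paths go straight to the clique; the last one passes through v to
       [K (p - 1)], the first clique neighbour of v. *)
    pose r (i : 'I_p) : seq G := if i < p.-1 then [::] else [:: inl false].
    apply: (@packing_from_prefixes G clique M p _ x y r (fun i => K i)) => //.
    - exact: linked_clique.
    - by move=> i; rewrite inE.
    - move=> i j /eqP; have ik := ltn_ord i; have jk := ltn_ord j; rewrite K_inj; try lia.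
      by move=> /eqP/val_inj.
    - by move=> i; rewrite /r; case: ifP.
    - move=> i; have := ltn_ord i; rewrite /r; case: ifP => ip ik.
        by apply/andP; split; rewrite // adj_K ?ip; lia.
      by apply/and3P; split; rewrite // adj_K ?ip; lia.
    - by move=> i; rewrite /r; case: ifP.
    - move=> i z; rewrite /r; case: ifP => // _; rewrite inE => /eqP->.
      by rewrite -ES.
    move=> i j z ij; rewrite /r; case: ifP => // i1; rewrite inE => /eqP->.
    case: ifP => //= j1; case/eqP: ij; apply/val_inj => /=.
    have := ltn_ord i; have := ltn_ord j; lia.
  (* From v, all [p] paths go straight to the clique; the largest index [2p - 2] is below [q]. *)
  apply: (@packing_from_prefixes G clique M p _ x y (fun=> [::])
            (fun i => K (p.-1 + i))) => //.
  - exact: linked_clique.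
  - by move=> i; rewrite inE.
  - move=> i j /eqP; have ik := ltn_ord i; have jk := ltn_ord j; rewrite K_inj; try lia.
    by rewrite eqn_add2l => /eqP/val_inj.
  - move=> i; have ik := ltn_ord i; apply/andP; split; rewrite // adj_K; last lia.
    by rewrite ltnNge leq_addr.
have [uS|uS] := boolP (inl true \in S); have [vS|vS] := boolP (inl false \in S).
- have [x [y [ES ux uy xy]]] := card3P cS uS.
  have : inl false \in S by [].
  rewrite {1}ES !inE /= => /orP[] /eqP vE; [move: y ux uy xy ES | move: x ux uy xy ES].
    by move=> [[//|]|c] _ _; rewrite -vE // => _ ->; apply: packing_two_special.
  move=> [[//|]|c] _ _; rewrite -vE // => _; rewrite [X in _ |: X]setUC => ->.
  exact: packing_two_special.
- by apply: (one true).
- by apply: (one false).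
have [a aS] : exists a, a \in S by apply/card_gt0P; rewrite cS.
have [b [c [ES ab ac bc]]] := card3P cS aS.
have R z : z \in S -> z \in clique.
  by move=> zS; apply: cliqueP; [apply: contraNneq uS | apply: contraNneq vS] => <-.
rewrite ES; apply: (packing_linked linked_clique) => //; apply: R;
  by rewrite ES !inE eqxx ?orbT.
Qed.

Lemma path_connectivity_attached : path_connectivity G 3 = p.
Proof.
have cG : 3 <= #|G| by rewrite card_sum card_bool card_ord; lia.
apply/eqP; rewrite eqn_leq; apply/andP; split; last first.
  by have [S cS ->] := path_connectivityP cG; apply: packing_attached.
(* Any triple containing u gives the upper bound, u having degree at most [p]. *)
pose S : {set G} := inl true |: [set K 0; K 1].
have cS : #|S| = 3 by rewrite /S cardsU1 cards2 K_inj ?inE //; lia.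
apply: leq_trans (path_connectivity_le cS) (leq_trans _ degree_true).
by apply: local_path_connectivity_le_degree; rewrite ?cS // !inE.
Qed.

(** * The line graph and its path 3-connectivity *)

Lemma mem_edges (x y : G) : adj x y -> [set x; y] \in edges G.
Proof. by move=> xy; apply/imsetP; exists (x, y); rewrite ?inE. Qed.

Definition edge_of (x y : G) (xy : adj x y) : L := exist _ [set x; y] (mem_edges xy).

Lemma edge_ofP (e : L) : exists x y (xy : adj x y), e = edge_of xy.
Proof.
have /imsetP[[x y] + E] := valP e; rewrite inE => xy; exists x, y, xy.
by apply/val_inj.
Qed.

Lemma adj_line (e f : L) (x : G) : e != f -> x \in val e -> x \in val f -> adj e f.
Proof.
move=> ef xe xf; apply/andP; split=> //.
by apply/set0Pn; exists x; rewrite inE xe.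
Qed.

Definition central : L := @edge_of (inl true) (inl false) isT.

Lemma adj_pendant (i : 'I_q) : @adj G (inl (i < p.-1)) (K i).
Proof. by rewrite adj_K. Qed.

(** The [q] edges between u, v and the clique; the boolean [i < p.-1] selects the one of u and v to
    which [K i] is attached. *)
Definition pendant (i : 'I_q) : L := edge_of (adj_pendant i).

Definition rich : {set L} := [set e : L | e != central].

(** An edge without an end in the clique has ends u and v, so it is [central]. *)
Lemma richP (e : L) : e \in rich -> exists i, inr i \in val e.
Proof.
have [x [y [xy ->]]] := edge_ofP e; rewrite inE.
case: x y xy => [b|i] [b'|j] xy.
- case/eqP; apply/val_inj => /=; case: b b' xy => [] [] // _.
  by rewrite setUC.
- by exists j; rewrite !inE eqxx orbT.
- by exists i; rewrite !inE eqxx.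
- by exists j; rewrite !inE eqxx orbT.
Qed.

(** If [x] and [y] have clique ends [i] and [j], the edges iz, zw, wj form a link for any two clique
    vertices [z], [w] not covered by the forbidden edges. These are at most [M + 2] edges covering
    at most [2 * M + 4] vertices, so [hn] leaves room for [z] and [w]. *)
Lemma linked_rich : linked rich M.
Proof.
move=> x y F0 /richP[i xi] /richP[j yj] cF0.
(* Including [x] and [y] makes [i] and [j] covered, so that [z] and [w] differ from them and the new
   edges differ from [x] and [y]. *)
set F := x |: (y |: F0).
have cF : #|F| <= M + 2.
  by apply: leq_trans (cardsU_le _ _) _; rewrite cards1 cardsU1; lia.
pose C := [set z : 'I_n.+1 | inr z \in \bigcup_(e in F) val e].
have cC : #|C| <= 2 * M + 4.
  apply: (@leq_trans #|\bigcup_(e in F) val e|).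
    rewrite -(@card_imset _ _ (inr : _ -> G)); last by move=> ? ? [].
    by apply/subset_leq_card/subsetP => _ /imsetP[z + ->]; rewrite inE.
  apply: (@leq_trans (\sum_(e in F) 2)); last by rewrite sum_nat_const; lia.
  elim/big_ind2: _ => [|A m B k hA hB|e _]; first by rewrite cards0.
    by apply: leq_trans (cardsU_le _ _) _; apply: leq_add.
  by have [u [v [uv ->]]] := edge_ofP e; rewrite cards2; case: (u != v).
have CP (e : L) z : e \in F -> inr z \in val e -> z \in C.
  by move=> eF ze; rewrite inE; apply/bigcupP; exists e.
have [xF yF] : x \in F /\ y \in F by rewrite !inE !eqxx orbT.
have iC := CP _ _ xF xi; have jC := CP _ _ yF yj.
have [z zC] : exists z, z \notin C.
  by apply: fresh_ord; apply: leq_trans cC _; lia.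
have [w] : exists w, w \notin z |: C.
  apply: fresh_ord; rewrite cardsU1 zC; apply: leq_trans (_ : 1 + (2 * M + 4) <= _).
    by rewrite leq_add2l.
  by lia.
rewrite in_setU1 negb_or => /andP[wz wC].
have neC t t' : t \in C -> t' \notin C -> t != t'.
  by move=> tC; apply: contraNneq => <-.
have iz : @adj G (inr i) (inr z) by apply: neC.
have zw : @adj G (inr z) (inr w) by rewrite /= eq_sym.
have wj : @adj G (inr w) (inr j) by rewrite adj_sym; apply: neC.
(* Each of the three new edges has [z] or [w] as an end, so it is not forbidden. *)
have nF (e : L) t : inr t \in val e -> t \notin C -> e \notin F.
  by move=> te; apply: contra => /CP; apply.
have ne (e f : L) : e \in F -> f \notin F -> e != f.
  by move=> eF; apply: contraNneq => <-.
have m1 : edge_of iz \notin F by apply: (nF _ z); rewrite // !inE eqxx orbT.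
have m2 : edge_of zw \notin F by apply: (nF _ z); rewrite // !inE eqxx.
have m3 : edge_of wj \notin F by apply: (nF _ w); rewrite // !inE eqxx.
have sep (e f : L) (t : G) : t \in val e -> t \notin val f -> e != f.
  by move=> te; apply: contraNneq => <-.
have inrE (t t' : 'I_n.+1) : (inr t == inr t' :> G) = (t == t') by [].
have m12 : edge_of iz != edge_of zw.
  by apply: (sep _ _ (inr i)); rewrite !inE ?eqxx // !inrE negb_or !neC.
have m13 : edge_of iz != edge_of wj.
  rewrite eq_sym; apply: (sep _ _ (inr w)); rewrite !inE ?eqxx // !inrE.
  by rewrite negb_or wz eq_sym neC.
have m23 : edge_of zw != edge_of wj.
  apply: (sep _ _ (inr z)); rewrite !inE ?eqxx // !inrE.
  by rewrite negb_or eq_sym wz eq_sym neC.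
exists [:: edge_of iz; edge_of zw; edge_of wj]; split=> //.
- apply/and5P; split=> //.
  + by apply: (@adj_line _ _ (inr i)); rewrite ?ne // !inE eqxx.
  + by apply: (@adj_line _ _ (inr z)); rewrite // !inE eqxx ?orbT.
  + by apply: (@adj_line _ _ (inr w)); rewrite // !inE eqxx ?orbT.
  + by apply: (@adj_line _ _ (inr j)); rewrite 1?eq_sym ?ne // !inE eqxx orbT.
- by rewrite /= !inE negb_or m12 m13 m23.
have sF e : e \notin F -> e \notin F0.
  by apply: contra => eF; rewrite !inE eF !orbT.
by move=> e; rewrite !inE => /or3P[] /eqP->; apply: sF.
Qed.

(** An edge other than uv that meets uv joins u or v to the clique, hence is one of the [q] pendant
    edges. *)
Lemma degree_central : #|[set e : L | adj central e]| <= q.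
Proof.
apply: (@leq_trans #|pendant @: setT|); last first.
  by apply: leq_trans (leq_imset_card _ _) _; rewrite cardsT card_ord.
apply/subset_leq_card/subsetP => e; rewrite inE => /andP[].
have [x [y [xy ->]]] := edge_ofP e.
case: x y xy => [b|i] [b'|j] xy.
- by case/eqP; apply/val_inj => /=; case: b b' xy => [] [] //; rewrite setUC.
- move=> _ _; have /andP[jq /eqP bj] := xy.
  apply/imsetP; exists (Ordinal jq); rewrite //.
  by apply/val_inj; rewrite /= /K inord_val -bj.
- move=> _ _; have /andP[jq /eqP bj] := xy.
  apply/imsetP; exists (Ordinal jq); rewrite //.
  by apply/val_inj; rewrite /= /K inord_val -bj setUC.
by move=> _ /set0Pn[t]; rewrite !inE => /andP[/orP[] /eqP->].
Qed.

Lemma pendant_inj : injective pendant.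
Proof.
move=> i j /(congr1 val)/setP/(_ (K i)); rewrite !inE eqxx orbT /=.
by move=> /esym; rewrite K_inj // => /eqP/val_inj.
Qed.

Lemma pendant_rich i : pendant i \in rich.
Proof.
by rewrite inE; apply/eqP => /(congr1 val)/setP/(_ (K i)); rewrite !inE eqxx orbT.
Qed.

Lemma packing_line_attached (S : {set L}) :
  #|S| = 3 -> q <= local_path_connectivity S.
Proof.
move=> cS; have [cS'|nS] := boolP (central \in S).
  have [b [c [-> ab ac bc]]] := card3P cS cS'.
  (* The [q] paths leave uv directly through the [q] pendant edges, some of which may themselves be
     in [S]. *)
  apply: (@packing_from_prefixes L rich M q _ b c (fun=> [::]) pendant) => //.
  - exact: linked_rich.
  - by rewrite inE eq_sym.
  - by rewrite inE eq_sym.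
  - exact: pendant_rich.
  - exact: pendant_inj.
  - move=> i; apply/andP; split=> //; apply: (@adj_line _ _ (inl (i < p.-1))).
    + by have := pendant_rich i; rewrite inE eq_sym.
    + by rewrite !inE; case: (i < p.-1).
    + by rewrite !inE eqxx.
  - by move=> i; rewrite /= andbT inE eq_sym; have := pendant_rich i; rewrite inE.
have [a aS] : exists a, a \in S by apply/card_gt0P; rewrite cS.
have [b [c [ES ab ac bc]]] := card3P cS aS.
have R z : z \in S -> z \in rich by move=> zS; rewrite inE; apply: contraNneq nS => <-.
rewrite ES; apply: (packing_linked linked_rich) => //; apply: R;
  by rewrite ES !inE eqxx ?orbT.
Qed.

Lemma path_connectivity_line_attached : path_connectivity L 3 = q.
Proof.
have q0 : 0 < q by lia. have q1 : 1 < q by lia.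
pose S : {set L} := central |: [set pendant (Ordinal q0); pendant (Ordinal q1)].
have cS : #|S| = 3.
  rewrite /S cardsU1 cards2 (inj_eq pendant_inj) !inE negb_or.
  by have := pendant_rich (Ordinal q0); have := pendant_rich (Ordinal q1);
    rewrite !inE ![central == _]eq_sym => -> ->.
have cL : 3 <= #|L| by rewrite -cS max_card.
apply/eqP; rewrite eqn_leq; apply/andP; split; last first.
  by have [S' cS' ->] := path_connectivityP cL; apply: packing_line_attached.
apply: leq_trans (path_connectivity_le cS) (leq_trans _ degree_central).
by apply: local_path_connectivity_le_degree; rewrite ?cS // !inE eqxx.
Qed.

End Construction.

Theorem theorem3p5 (p q : nat) (hqp : 2 * p - 1 <= q) (hp : 2 <= p) (hq : 3 <= q) :
  exists G : sgraph,
    path_connectivity G 3 = p /\ path_connectivity (line_graph G) 3 = q.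
Proof.
(* The least value of [n] that [hn] admits. *)
exists (attached_graph p q (2 * (15 * q + 30) + 6)); split.
  exact: path_connectivity_attached.
exact: path_connectivity_line_attached.
Qed.
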